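(* For every integer $d$ with $3\le d\le17$ there exist distinct integers $k_1,k_2,k_3,k_4\in\{1,\dots,d+1\}$, with $(k_1,k_2,k_3,k_4)$ of the form $(d+1,1,2,m)$ or $(d+1,1,3,m)$, a real number $a>0$ with $a\ne1$, and nonnegative real numbers $\lambda_1,\dots,\lambda_5$ with $\sum_{j=1}^5\lambda_j=1$, such that $$ d!\int_{T^d}f(x,1-|x|_1)\,dx=\sum_{j=1}^4\frac{\lambda_j}{\binom{d+1}{k_j}}\sum_{x\in v_{k_j}S_{d+1}}f\Big(\frac{x}{k_j}\Big)+\frac{\lambda_5}{d+1}\sum_{x\in u_aS_{d+1}}f\Big(\frac{x}{a+d}\Big) $$ for every homogeneous polynomial $f$ of degree $4$ in $d+1$ variables. (Thus there is a positive cubature rule of degree $4$, of this form, for the unit weight function on the simplex $T^d$ for $d=3,4,\dots,17$.)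
   Context: $T^d=\{x\in\mathbb{R}^d:x_i\ge0,\ |x|_1\le1\}$, $|x|_1=x_1+\dots+x_d$. $v_k=(1,\dots,1,0,\dots,0)\in\mathbb{R}^{d+1}$ ($k$ ones), $u_a=(a,1,\dots,1)\in\mathbb{R}^{d+1}$ ($d$ ones after $a$). For $y\in\mathbb{R}^{d+1}$, $yS_{d+1}$ is the set of distinct points obtained from $y$ by permuting coordinates. Orbits whose coefficient $\lambda_j$ vanishes are simply omitted from the rule. *)

(* Defs.v *)
From HB Require Import structures.
From mathcomp Require Import all_boot all_order all_algebra all_fingroup.
(* Without its notations, which clash with those of the analysis library. *)
From mathcomp Require Import -(notations) mpoly.
From mathcomp Require Import all_classical all_reals all_analysis.

Set Implicit Arguments.
Unset Strict Implicit.
Unset Printing Implicit Defensive.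

Import Order.TTheory GRing.Theory Num.Theory.
Import numFieldNormedType.Exports.

Local Open Scope classical_set_scope.
Local Open Scope ring_scope.

(* R^n is n.-tuple R.  Spelled n.-tuple (measurableTypeR R), it carries the
   product of n copies of the Borel sigma-algebra. *)

Definition cons_coord (R : realType) (n : nat)
    (p : n.-tuple (measurableTypeR R) * measurableTypeR R) :
  n.+1.-tuple (measurableTypeR R) := [tuple of p.2 :: p.1].

Lemma measurable_cons_coord (R : realType) (n : nat) :
  measurable_fun [set: n.-tuple (measurableTypeR R) * measurableTypeR R]
    (@cons_coord R n).
Proof. exact: measurable_cons. Qed.

Section cons_measure.
Context (R : realType) (n : nat).
Variable mu : {measure set (n.-tuple (measurableTypeR R)) -> \bar R}.

(* The product of mu with Lebesgue measure on the line, carried over to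
   R^n.+1; the new coordinate comes first. *)
Definition cons_measure : set (n.+1.-tuple (measurableTypeR R)) -> \bar R :=
  pushforward (mu \x @lebesgue_measure R)%E (@cons_coord R n).

Let cons_measure0 : cons_measure set0 = 0%E.
Proof. by rewrite /cons_measure /pushforward preimage_set0 measure0. Qed.

Let cons_measure_ge0 A : (0 <= cons_measure A)%E.
Proof. by rewrite /cons_measure /pushforward; exact: measure_ge0. Qed.

Let cons_measure_sigma_additive : semi_sigma_additive cons_measure.
Proof.
apply: (@measure_semi_sigma_additive _ _ _ (pushforward _ _)).
exact: measurable_cons_coord.
Qed.

HB.instance Definition _ := isMeasure.Build _ _ _ cons_measure
  cons_measure0 cons_measure_ge0 cons_measure_sigma_additive.

End cons_measure.

(* Lebesgue measure on R^n; see lebesgue_tuple_box. *)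
Fixpoint lebesgue_tuple (R : realType) (n : nat) :
    {measure set (n.-tuple (measurableTypeR R)) -> \bar R} :=
  match n with
  | 0 => \d_ [tuple]
  | n'.+1 => cons_measure (lebesgue_tuple R n')
  end.

Lemma lebesgue_tuple_box (R : realType) (n : nat)
    (A : 'I_n -> set (measurableTypeR R)) :
  (forall i, measurable (A i)) ->
  lebesgue_tuple R n [set x | forall i, A i (tnth x i)] =
  (\prod_(i < n) lebesgue_measure (A i))%E.
Proof.
elim: n A => [|n IHn] A mA.
  rewrite big_ord0 /= diracE mem_set//= => -[].
  by [].
rewrite big_ord_recl -IHn; last by move=> i; exact: mA.
set B := [set x : n.-tuple _ | _].
have mB : measurable B.
  have -> : B = \bigcap_(i in [set: 'I_n]) ((@tnth n _)^~ i @^-1` A (lift ord0 i)).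
    by apply/seteqP; split=> x /= Bx i; [move=> _; exact: Bx|exact: Bx].
  apply: fin_bigcap_measurable => // i _.
  by rewrite -[X in measurable X]setTI; apply: measurable_tnth.
rewrite /= /cons_measure /pushforward muleC -product_measure1E//.
congr (_ _); apply/seteqP; split=> -[t x] /=.
  by move=> H; split; [move=> i; have := H (lift ord0 i); rewrite tnthS|exact: (H ord0)].
move=> [Bt Ax] i; have [j ->|->//] := unliftP ord0 i.
by rewrite tnthS; exact: Bt.
Qed.

Definition std_simplex (R : realType) (d : nat) :
    set (d.-tuple (measurableTypeR R)) :=
  [set x | (forall i, 0 <= tnth x i) /\ \sum_(i < d) tnth x i <= 1].

(* The point (x, 1 - |x|_1) of R^(d+1). *)
Definition lift_simplex (R : realType) (d : nat) (x : d.-tuple R) :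
    d.+1.-tuple R :=
  [tuple of rcons x (1 - \sum_(i < d) tnth x i)].

Definition vpt (R : realType) (d k : nat) : d.+1.-tuple R :=
  [tuple if (i < k)%N then 1 else 0 | i < d.+1].

Definition upt (R : realType) (d : nat) (a : R) : d.+1.-tuple R :=
  [tuple if i == ord0 then a else 1 | i < d.+1].

Definition perm_orbit (R : realType) (n : nat) (y : n.-tuple R) :
    set (n.-tuple R) :=
  range (fun s : 'S_n => [tuple tnth y (s i) | i < n]).

(* f(x / c) for a polynomial f in n variables. *)
Definition eval_at (R : realType) (n : nat) (f : mpoly n R)
    (c : R) (x : n.-tuple R) : R :=
  meval (fun i => tnth x i / c) f.

(* Main.v *)
(** Averaging a monomial with exponent e of degree 4 over the orbit of v_k / k
    gives k^-4 (k)_s / (n)_s, where n = d + 1, s is the number of nonzero e_i and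
    (.)_s is the falling factorial, while the Dirichlet integral gives
    (prod e_i!) / (n (n + 1) (n + 2) (n + 3)).  The rule is thus exact iff five
    linear equations hold, one for each partition 4, 31, 22, 211, 1111.  Orbits
    of 0/1 vectors do not distinguish 31 from 22, so the difference of these two
    equations determines the coefficient of the orbit of u_a; the other four
    equations are then an interpolation problem with nodes n, 1, 3, m for
    polynomials of degree at most 4 vanishing at 0.
    It remains to choose m and a, for each d, so that the solution is
    nonnegative. *)

Require Import Defs.
From HB Require Import structures.
From mathcomp Require Import all_boot all_order all_algebra all_fingroup.
From mathcomp Require Import -(notations) mpoly.
From mathcomp Require Import all_classical all_reals all_analysis.
From mathcomp Require Import measurable_realfun zify ring lra.

Set Implicit Arguments.
Unset Strict Implicit.
Unset Printing Implicit Defensive.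

Import Order.TTheory GRing.Theory Num.Theory.
Import numFieldNormedType.Exports.

Local Open Scope classical_set_scope.
Local Open Scope ring_scope.

(** * Beta integrals on a segment *)

Lemma integral_deriv_horner (R : realType) (p : {poly R}) (s : R) : 0 <= s ->
  (\int[@lebesgue_measure R]_(x in `[0%R, s]) (p^`().[x])%:E = (p.[s] - p.[0])%:E)%E.
Proof.
rewrite le_eqVlt => /predU1P[<-|s0].
  by rewrite set_itv1 integral_set1 subrr.
rewrite EFinB; apply: continuous_FTC2 => //.
- by apply: continuous_subspaceT => x; exact: continuous_horner.
- split.
  + by move=> x _; exact: derivable_horner.
  + by apply: cvg_at_right_filter; exact: continuous_horner.
  + by apply: cvg_at_left_filter; exact: continuous_horner.
- by move=> x _; rewrite derivE.
Qed.

Lemma integrable_horner (R : realType) (p : {poly R}) (s : R) :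
  (@lebesgue_measure R).-integrable `[0, s] (EFin \o horner p).
Proof.
apply: continuous_compact_integrable; first exact: segment_compact.
by apply: continuous_subspaceT => x; exact: continuous_horner.
Qed.

(** Induction on [a]: the polynomial x^(a+1) (s-x)^(b+1) vanishes at both ends of [0, s], so
    integrating its derivative trades one factor s-x for a factor x. The base case uses the
    antiderivative -(s-x)^(b+1) / (b+1). *)
Lemma Rintegral_beta (R : realType) (a b : nat) (s : R) : 0 <= s ->
  \int[@lebesgue_measure R]_(x in `[0, s]) (x ^+ a * (s - x) ^+ b) =
  (a`! * b`!)%:R / (a + b).+1`!%:R * s ^+ (a + b).+1.
Proof.
move=> s0.
have pE i j x : (('X^i * (s%:P - 'X) ^+ j : {poly R}).[x]) = x ^+ i * (s - x) ^+ j.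
  by rewrite !hornerE.
have intZ k i j : (@lebesgue_measure R).-integrable `[0, s]
    (EFin \o (fun x => k * (x ^+ i * (s - x) ^+ j))).
  apply: eq_integrable
    (integrable_horner (k *: ('X^i * (s%:P - 'X) ^+ j)) s) => //.
  by move=> x _; rewrite /= hornerZ pE.
have intP i j : (@lebesgue_measure R).-integrable `[0, s]
    (EFin \o (fun x => x ^+ i * (s - x) ^+ j)).
  by apply: eq_integrable (intZ 1 i j) => // x _; rewrite /= mul1r.
have fact0R k : k`!%:R != 0 :> R by rewrite pnatr_eq0 -lt0n fact_gt0.
elim: a b => [|a IHa] b.
  have := @integral_deriv_horner R (- b.+1%:R^-1 *: (s%:P - 'X) ^+ b.+1) s s0.
  rewrite derivZ deriv_exp derivB derivC derivX sub0r.
  under eq_integral => x _.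
    rewrite (_ : _.[x] = x ^+ 0 * (s - x) ^+ b); last first.
      rewrite !(hornerE, hornerMn) -[X in _ * X]mulr_natl; field.
      by rewrite nat1r pnatr_eq0.
    over.
  rewrite /Rintegral => -> /=.
  rewrite !hornerE subrr expr0n /= mulr0 sub0r subr0 mulNr opprK.
  rewrite factS natrM; field.
  by rewrite fact0R nat1r pnatr_eq0.
have := @integral_deriv_horner R ('X^(a.+1) * (s%:P - 'X) ^+ b.+1) s s0.
have dE x : ((('X^(a.+1) * (s%:P - 'X) ^+ b.+1 : {poly R})^`()).[x]) =
    a.+1%:R * (x ^+ a * (s - x) ^+ b.+1) - b.+1%:R * (x ^+ a.+1 * (s - x) ^+ b).
  rewrite derivM !deriv_exp derivX derivB derivC derivX sub0r.
  rewrite !(hornerE, hornerMn) /=.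
  rewrite -[_ *+ a.+1]mulr_natl -[_ *+ b.+1]mulr_natl.
  by move: (a.+1%:R : R) (b.+1%:R : R) (x ^+ a) (x ^+ a.+1) => *; ring.
under eq_integral do rewrite dE.
move=> /(congr1 fine); rewrite -/(Rintegral _ _ _) RintegralB//; [|exact: intZ..].
rewrite !RintegralZl//.
rewrite IHa /= !pE subrr !expr0n /= mulr0 mul0r subrr => H.
have b0 : b.+1%:R != 0 :> R by rewrite pnatr_eq0.
apply: (mulfI b0); move/eqP: H; rewrite subr_eq0 => /eqP <-.
rewrite addnS addSn; move: (fact0R (a + b).+2).
move: ((a + b).+2)`!%:R => F F0.
by rewrite !factS !natrM; field.
Qed.

(** * Iterated integration against Lebesgue measure on R^n *)

Lemma sigma_finite_lebesgue_tuple (R : realType) (n : nat) :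
  sigma_finite setT (lebesgue_tuple R n).
Proof.
exists (fun k => [set x | forall i, `[- k%:R, k%:R]%classic (tnth x i)]).
  apply/seteqP; split=> // x _.
  exists (Num.truncn (\sum_(i < n) `|tnth x i|)).+1 => // i /=.
  rewrite in_itv /= -ler_norml.
  apply: le_trans (ltW (truncnS_gt _)).
  by rewrite (bigD1 i) //= lerDl sumr_ge0.
move=> k; split.
  have -> : [set x : n.-tuple (measurableTypeR R) |
      forall i, `[- k%:R, k%:R]%classic (tnth x i)] =
      \bigcap_(i in [set: 'I_n]) ((@tnth n _)^~ i @^-1` `[- k%:R, k%:R]).
    by apply/seteqP; split=> x /= Bx i; [move=> _; exact: Bx|exact: Bx].
  apply: fin_bigcap_measurable => // i _.
  by rewrite -[X in measurable X]setTI; apply: measurable_tnth.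
rewrite (@lebesgue_tuple_box _ _ (fun=> `[- k%:R, k%:R]%classic)) //.
under eq_bigr do rewrite lebesgue_measure_itv /=.
rewrite ltey_eq; apply/orP; left.
elim/big_ind : _ => // [x y|i _]; first exact: fin_numM.
by case: ifP.
Qed.

Lemma integral_lebesgue_tupleS (R : realType) (n : nat)
    (f : n.+1.-tuple (measurableTypeR R) -> \bar R) :
  measurable_fun setT f -> (forall x, 0 <= f x)%E ->
  (\int[lebesgue_tuple R n.+1]_x f x =
   \int[lebesgue_tuple R n]_x \int[@lebesgue_measure R]_y f (cons_coord (x, y)))%E.
Proof.
move=> mf f0.
have sigmaf := sigma_finite_lebesgue_tuple R n.
(* [lebesgue_tuple R n] is declared only as a measure; Tonelli's theorem asks for a sigma-finite
   one, so that structure is attached to it here. *)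
pose isf := isSigmaFinite.Build _ _ R (lebesgue_tuple R n) sigmaf.
pose iss := isSFinite.Build _ _ R (lebesgue_tuple R n)
  (sfinite_measure_sigma_finite sigmaf).
pose m1 : {sigma_finite_measure set (n.-tuple (measurableTypeR R)) -> \bar R} :=
  HB.pack (Measure.sort (lebesgue_tuple R n)) isf iss.
transitivity (\int[(lebesgue_tuple R n \x @lebesgue_measure R)%E]_z
    (f \o @cons_coord R n) z)%E.
  exact: (ge0_integral_pushforward (@measurable_cons_coord R n)
    (lebesgue_tuple R n \x @lebesgue_measure R)%E measurableT mf (fun y _ => f0 y)).
have := @fubini_tonelli1 _ _ _ _ R m1 (@lebesgue_measure R)
  (f \o @cons_coord R n).
apply=> [|x]; last exact: f0.
by apply: (measurableT_comp mf); exact: measurable_cons_coord.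
Qed.

(** * Dirichlet integrals over the simplex *)

Lemma measurable_sum_tnth (R : realType) (n : nat) :
  measurable_fun [set: n.-tuple (measurableTypeR R)]
    (fun x => \sum_(i < n) tnth x i : R).
Proof. by apply: measurable_sum => i; exact: measurable_tnth. Qed.

Lemma measurable_std_simplex (R : realType) (n : nat) :
  measurable (@std_simplex R n).
Proof.
have -> : @std_simplex R n =
    \bigcap_(i in [set: 'I_n]) ((@tnth n _)^~ i @^-1` `[0, +oo[) `&`
    (fun x : n.-tuple (measurableTypeR R) => \sum_(i < n) tnth x i) @^-1` `]-oo, 1].
  apply/seteqP; split=> x /=.
    by move=> [x0 x1]; split=> [i _|] /=; rewrite in_itv /= ?andbT.
  by move=> [x0 x1]; split=> [i|]; [have := x0 i I|move: x1];
    rewrite /= in_itv /= ?andbT.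
apply: measurableI.
  apply: fin_bigcap_measurable => // i _.
  by rewrite -[X in measurable X]setTI; apply: measurable_tnth.
by rewrite -[X in measurable X]setTI; apply: measurable_sum_tnth.
Qed.

(** The unnormalised Dirichlet density, a monomial in barycentric coordinates. The exponent [b] of
    the last coordinate is kept apart because it absorbs the others in the induction. *)
Definition dirichlet (R : realType) (n : nat) (al : 'I_n -> nat) (b : nat)
    (x : n.-tuple (measurableTypeR R)) : R :=
  \prod_(i < n) tnth x i ^+ al i * (1 - \sum_(i < n) tnth x i) ^+ b.

Lemma measurable_dirichlet (R : realType) (n : nat) (al : 'I_n -> nat) b :
  measurable_fun setT (@dirichlet R n al b).
Proof.
apply: measurable_funM.
  apply: measurable_prod => i _; apply: measurable_funX; exact: measurable_tnth.
apply: measurable_funX; apply: measurable_funB => //; exact: measurable_sum_tnth.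
Qed.

Lemma dirichlet_ge0 (R : realType) (n : nat) (al : 'I_n -> nat) b x :
  std_simplex x -> 0 <= @dirichlet R n al b x.
Proof.
move=> [x0 x1]; apply: mulr_ge0; last by rewrite exprn_ge0 ?subr_ge0.
by apply: prodr_ge0 => i _; rewrite exprn_ge0.
Qed.

Lemma integral_beta (R : realType) (a b : nat) (s : R) : 0 <= s ->
  (\int[@lebesgue_measure R]_(x in `[0%R, s]) (x ^+ a * (s - x) ^+ b)%:E =
  ((a`! * b`!)%:R / (a + b).+1`!%:R * s ^+ (a + b).+1)%:E)%E.
Proof.
move=> s0; rewrite -Rintegral_beta // fineK //.
apply: integrable_fin_num => //.
apply: eq_integrable (integrable_horner ('X^a * (s%:P - 'X) ^+ b) s) => //.
by move=> x _; rewrite /= !hornerE.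
Qed.

Lemma dirichlet_cons (R : realType) (n : nat) (al : 'I_n.+1 -> nat) b
    (x : n.-tuple (measurableTypeR R)) (y : R) :
  dirichlet al b (cons_coord (x, y : measurableTypeR R)) =
  \prod_(i < n) tnth x i ^+ al (lift ord0 i) *
  (y ^+ al ord0 * (1 - \sum_(i < n) tnth x i - y) ^+ b).
Proof.
rewrite /dirichlet !big_ord_recl /cons_coord /= !tnth0.
under eq_bigr do rewrite tnthS.
under [in X in 1 - X]eq_bigr do rewrite tnthS.
by rewrite opprD addrA addrAC -mulrA mulrCA.
Qed.

Lemma std_simplex_cons (R : realType) (n : nat) (x : n.-tuple (measurableTypeR R)) (y : R) :
  std_simplex (cons_coord (x, y : measurableTypeR R)) <->
  std_simplex x /\ y \in `[0, 1 - \sum_(i < n) tnth x i].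
Proof.
rewrite /std_simplex /= big_ord_recl tnth0 in_itv /= lerBrDr.
under [X in _ + X <= _]eq_bigr do rewrite tnthS.
split=> [[xy0 xy1]|[[x0 x1] /andP[y0 yx]]].
  have y0 : 0 <= y by have := xy0 ord0; rewrite tnth0.
  split; [split=> [i|]|].
  - by have := xy0 (lift ord0 i); rewrite tnthS.
  - by apply: le_trans xy1; rewrite lerDr.
  - by rewrite y0.
split=> // i; have [j ->|->] := unliftP ord0 i; first by rewrite tnthS.
by rewrite tnth0.
Qed.

Lemma integral_dirichlet (R : realType) (n : nat) (al : 'I_n -> nat) b :
  (\int[lebesgue_tuple R n]_(x in @std_simplex R n) (dirichlet al b x)%:E =
  ((\prod_i (al i)`! * b`!)%:R / (n + \sum_i al i + b)`!%:R)%:E)%E.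
Proof.
(* Integrating out the first coordinate, a beta integral over
   [0, 1 - |x|_1], only raises the exponent of 1 - |x|_1. *)
elim: n al b => [|n IHn] al b.
  rewrite integral_dirac; last 2 first.
  - exact: measurable_std_simplex.
  - apply/measurable_EFinP; apply: measurable_funTS; exact: measurable_dirichlet.
  rewrite diracE mem_set; last by split; [case|rewrite big_ord0].
  by rewrite mul1e /dirichlet !big_ord0 subr0 expr1n !mul1r mul1n divff //
    pnatr_eq0 -lt0n fact_gt0.
have mD : measurable_fun setT
    ((fun x => (dirichlet al b x)%:E) \_ (@std_simplex R n.+1)).
  apply/(measurable_restrictT _ (@measurable_std_simplex R n.+1)).
  apply/measurable_EFinP; apply: measurable_funTS; exact: measurable_dirichlet.
rewrite integral_mkcond integral_lebesgue_tupleS //; last first.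
  move=> x; rewrite patchE; case: ifPn => // /set_mem.
  by rewrite lee_fin; exact: dirichlet_ge0.
pose a0 := al ord0; pose al' := fun i => al (lift ord0 i).
transitivity (\int[lebesgue_tuple R n]_(x in @std_simplex R n)
   (((a0`! * b`!)%:R / (a0 + b).+1`!%:R)%:E *
      (dirichlet al' (a0 + b).+1 x)%:E))%E.
  rewrite [RHS]integral_mkcond; apply: eq_integral => x _; rewrite patchE.
  case: ifPn => [/set_mem Sx|/negP Sx]; last first.
    apply: integral0_eq => y _; rewrite patchE memNset // => /std_simplex_cons[].
    by move=> /mem_set.
  have s0 : 0 <= 1 - \sum_(i < n) tnth x i by rewrite subr_ge0; case: Sx.
  transitivity (\int[@lebesgue_measure R]_(y in `[0%R, (1 - \sum_(i < n) tnth x i)%R])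
     ((\prod_(i < n) tnth x i ^+ al' i)%:E *
      (y ^+ a0 * (1 - \sum_(i < n) tnth x i - y) ^+ b)%:E))%E.
    rewrite [RHS]integral_mkcond; apply: eq_integral => y _.
    rewrite !patchE dirichlet_cons -EFinM.
    by congr (if _ then _ else _); apply/idP/idP => /set_mem;
      [move=> /std_simplex_cons[_ /mem_set]|
       move=> ?; apply/mem_set/std_simplex_cons].
  rewrite ge0_integralZl_EFin //.
  - by rewrite integral_beta // -!EFinM /dirichlet; congr EFin; ring.
  - move=> y; rewrite /= in_itv /= => /andP[y0 ys].
    by rewrite lee_fin mulr_ge0 ?exprn_ge0 ?subr_ge0.
  - apply/measurable_EFinP; apply: measurable_funTS; apply: measurable_funM.
      exact: measurable_funX.
    by apply: measurable_funX; exact: measurable_funB.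
  - by apply: prodr_ge0 => i _; rewrite exprn_ge0 //; case: Sx.
rewrite ge0_integralZl_EFin; last 4 first.
- exact: measurable_std_simplex.
- by move=> x Sx; rewrite lee_fin; exact: dirichlet_ge0.
- apply/measurable_EFinP; apply: measurable_funTS; exact: measurable_dirichlet.
- by rewrite divr_ge0.
rewrite IHn -EFinM; congr EFin.
rewrite !big_ord_recl -/a0 !addnS addSn.
rewrite (_ : n + _ + _ = n + (a0 + \sum_i al' i) + b)%N; last first.
  by rewrite -!addnA; congr addn; rewrite addnCA.
have: forall k, k`!%:R != 0 :> R by move=> k; rewrite pnatr_eq0 -lt0n fact_gt0.
move=> factR0; move: (factR0 (a0 + b).+1) (factR0 (n + (a0 + \sum_i al' i) + b).+1).
move: ((a0 + b).+1)`! (n + (a0 + \sum_i al' i) + b).+1`! => F G F0 G0.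
by rewrite !natrM; field; rewrite F0 G0.
Qed.

(** * Exponent vectors of degree 4 *)

(** The nonzero exponents form a partition of 4, which leaves five cases. The arguments of [T] are
    the only data of [m] on which the two sides of the rule depend: support size, product of
    factorials and power sum at [a]. *)
Lemma mdeg4_elim (R : realType) (n : nat) (a : R) (m : multinom n)
    (T : nat -> nat -> R -> Prop) : mdeg m = 4 ->
  T 1 24 (n%:R - 1 + a ^+ 4) ->
  T 2 6 (n%:R - 2 + a ^+ 3 + a) ->
  T 2 4 (n%:R - 2 + 2 * a ^+ 2) ->
  T 3 2 (n%:R - 3 + a ^+ 2 + 2 * a) ->
  T 4 1 (n%:R - 4 + 4 * a) ->
  T #|[pred i | m i != 0%N]| (\prod_(i < n) (m i)`!)%N (\sum_(i < n) a ^+ m i).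
Proof.
move=> m4 T4 T31 T22 T211 T1111.
pose c := [seq v <- m | v != 0%N].
have c_gt0 : all (fun v => 0 < v)%N c.
  by apply/allP => v; rewrite mem_filter lt0n => /andP[].
have sum_c : (\sum_(v <- c) v)%N = 4.
  rewrite -m4 /mdeg [RHS](bigID (fun v => v != 0%N)) /= big_filter.
  by rewrite [X in (_ + X)%N]big1 ?addn0 // => v; rewrite negbK => /eqP.
have -> : #|[pred i | m i != 0%N]| = size c.
  rewrite -sum1_card size_filter -sum1_count [RHS]big_tuple.
  by apply: eq_bigl => i; rewrite inE.
have -> : (\prod_(i < n) (m i)`! = \prod_(v <- c) v`!)%N.
  rewrite big_filter -(big_tuple _ _ m xpredT factorial).
  rewrite [LHS](bigID (fun v => v != 0%N)) /=.
  by rewrite [X in (_ * X)%N]big1 ?muln1 // => v; rewrite negbK => /eqP ->.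
(* Each zero exponent contributes a^0 = 1. *)
have -> : \sum_(i < n) a ^+ m i = n%:R - (size c)%:R + \sum_(v <- c) a ^+ v.
  rewrite -(big_tuple _ _ m xpredT (fun v => a ^+ v)) big_filter.
  rewrite [LHS](bigID (fun v => v != 0%N)) /= addrC; congr (_ + _).
  rewrite (eq_bigr (fun=> 1)) => [|v]; last by rewrite negbK => /eqP ->.
  rewrite big_const_seq iter_addr_0 -[in RHS](size_tuple m).
  rewrite -(count_predC (fun v => v != 0%N) m).
  by rewrite natrD size_filter addrAC subrr add0r.
have Teq s p x y : T s p x -> x = y -> T s p y by move=> ? <-.
(* At most four positive entries can sum to 4; the different orderings of a partition are identified
   by [ring]. *)
case: c c_gt0 sum_c => [|v1 [|v2 [|v3 [|v4 [|v5 c]]]]];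
  rewrite /= ?big_cons ?big_nil ?addn0 ?muln1 ?addr0.
- by [].
- by move=> _ ->.
- case: v1 => [|[|[|[|v1]]]] //; case: v2 => [|[|[|[|v2]]]] //;
    rewrite ?addSn ?addnS // => _ _.
  + by apply: Teq T31 _; ring.
  + by apply: Teq T22 _; ring.
  + by apply: Teq T31 _; ring.
- case: v1 => [|[|[|v1]]] //; case: v2 => [|[|[|v2]]] //;
    case: v3 => [|[|[|v3]]] //; rewrite ?addSn ?addnS // => _ _;
    by apply: Teq T211 _; ring.
- case: v1 => [|[|v1]] //; case: v2 => [|[|v2]] //; case: v3 => [|[|v3]] //;
    case: v4 => [|[|v4]] //; rewrite ?addSn ?addnS // => _ _.
  by apply: Teq T1111 _; ring.
- case: v1 => [|v1] //; case: v2 => [|v2] //; case: v3 => [|v3] //;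
    case: v4 => [|v4] //; case: v5 => [|v5] //.
  by rewrite ?addSn ?addnS.
Qed.

(** * Sums of monomials over the orbits *)

(** With denominators cleared, this says that a fraction (k)_s / (n)_s of the k-subsets of an n-set
    contains a given s-subset. For s > k both sides are 0. *)
Lemma bin_sub_ffact (n k s : nat) : (k <= n)%N -> (s <= n)%N ->
  ('C(n - s, n - k) * n ^_ s = 'C(n, k) * k ^_ s)%N.
Proof.
move=> kn; elim: s => [|s IHs] sn; first by rewrite subn0 bin_sub.
rewrite !ffactnSr [RHS]mulnA -IHs ?(ltnW sn) //.
have := mul_bin_down (n - s) (n - k); rewrite -subnS => H.
have -> : (k - s = n - s - (n - k))%N by lia.
by rewrite mulnCA (mulnC _ (n - s)%N) H mulnCA mulnC [X in (X * _)%N]mulnC.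
Qed.

(** Complementation turns supersets of [S] into subsets of its complement. The lower index [n - k]
    gives the right value 0 when #|S| > k, where the truncated difference k - #|S| would give 1. *)
Lemma card_supersets (n k : nat) (S : {set 'I_n}) : (k <= n)%N ->
  #|[pred A : {set 'I_n} | (S \subset A) && (#|A| == k)]| = 'C(n - #|S|, n - k).
Proof.
move=> kn.
have -> : (n - #|S| = #|~: S|)%N by rewrite -[X in (X - _)%N]card_ord -(cardsC S) addKn.
rewrite -(cards_draws (~: S) (n - k)%N).
rewrite -[RHS](card_imset _ (@finset.setC_inj _)).
apply: eq_card => A; rewrite !inE; apply/idP/imsetP.
  move=> /andP[SA /eqP kA]; exists (~: A); rewrite ?finset.setCK // !inE finset.setCS SA /=.
  by rewrite cardsCs finset.setCK kA card_ord.
move=> [B]; rewrite !inE => /andP[BS /eqP cB] ->.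
by rewrite finset.subsetC BS cardsCs finset.setCK cB card_ord subKn ?eqxx.
Qed.

Lemma fsbig_pred (R : nmodType) (I : finType) (P : pred I) (F : I -> R) :
  \sum_(i \in [set i | P i]) F i = \sum_(i | P i) F i.
Proof.
rewrite (fsbigE (enum P)) ?enum_uniq //=; last 2 first.
- by move=> i /=; rewrite mem_enum.
- by move=> i Pi; rewrite mem_enum /in_mem /= Pi.
rewrite big_enum_cond; apply: eq_bigl => i.
apply/andP/idP => [[]//|Pi]; split=> //; exact/mem_set.
Qed.

Definition bool_point (R : realType) (n : nat) (A : {set 'I_n}) : n.-tuple R :=
  [tuple (i \in A)%:R | i < n].

(** Replaces the orbit by the family of k-subsets, so that sums over it become counts of sets. *)
Lemma perm_orbit_vpt (R : realType) (d k : nat) : (k <= d.+1)%N ->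
  perm_orbit (vpt R d k) =
  @bool_point R d.+1 @` [set A : {set 'I_d.+1} | #|A| == k].
Proof.
move=> kd; apply/seteqP; split=> [_ [s _ <-]|_ [A /eqP Ak <-]] /=.
  exists (s @^-1: finset (fun i : 'I_d.+1 => (i < k)%N)); last first.
    apply/eq_from_tnth => i; rewrite !tnth_mktuple !inE.
    by case: ifP.
  rewrite card_preimset; last exact: perm_inj.
  rewrite -sum1_card; under eq_bigl do rewrite inE.
  rewrite (big_ord_narrow kd) /=. by rewrite sum_nat_const card_ord muln1.
(* The permutation sends each index to its position in this list, and the positions below k are
   exactly those of elements of [A]. *)
pose e := enum A ++ enum (~: A).
have ue : uniq e.
  rewrite cat_uniq !enum_uniq andbT /=; apply/hasPn => i.
  by rewrite !mem_enum inE.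
have e_all i : i \in e by rewrite mem_cat !mem_enum inE orbN.
have se : size e = d.+1.
  by rewrite size_cat -!cardE cardsC card_ord.
have idx_lt i : (index i e < d.+1)%N by move: (e_all i); rewrite -index_mem se.
have idx_inj : injective (fun i => Ordinal (idx_lt i)).
  move=> i j /(congr1 val) /= ij.
  by rewrite -(nth_index i (e_all i)) ij nth_index.
exists (perm idx_inj) => //; apply/eq_from_tnth => i.
rewrite !tnth_mktuple permE /= index_cat mem_enum.
case: (boolP (i \in A)) => iA.
  by rewrite -Ak cardE index_mem mem_enum iA.
by rewrite -Ak cardE ltnNge leq_addr.
Qed.

Lemma bool_point_inj (R : realType) (n : nat) : injective (@bool_point R n).
Proof.
move=> A B /(congr1 (fun t => tnth t)) AB; apply/setP => i.
have := congr1 (@^~ i) AB; rewrite !tnth_mktuple => /eqP.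
by rewrite eqr_nat; case: (i \in A); case: (i \in B).
Qed.

Lemma perm_orbit_upt (R : realType) (d : nat) (a : R) :
  perm_orbit (upt d a) =
  (fun j => [tuple if i == j then a else 1 | i < d.+1]) @` [set: 'I_d.+1].
Proof.
apply/seteqP; split=> [_ [s _ <-]|_ [j _ <-]] /=.
  exists ((s^-1)%g ord0) => //; apply/eq_from_tnth => i; rewrite !tnth_mktuple.
  by rewrite (can2_eq (permK s) (permKV s)).
exists (tperm j ord0) => //; apply/eq_from_tnth => i; rewrite !tnth_mktuple.
case: tpermP => [->|->|/eqP/negbTE ij /eqP/negbTE i0]; rewrite ?eqxx //.
  by rewrite eq_sym.
by rewrite ij i0.
Qed.

(** This gives the orbit exactly d + 1 points, in accordance with the divisor of lambda_5. *)
Lemma upt_point_inj (R : realType) (d : nat) (a : R) : a != 1 ->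
  injective (fun j => [tuple if i == j then a else 1 | i < d.+1]).
Proof.
move=> a1 j j' /(congr1 (fun t => tnth t j)); rewrite !tnth_mktuple eqxx.
by case: eqP => // _ a_eq; rewrite a_eq eqxx in a1.
Qed.

Lemma prod_div_mdeg (R : realType) (n : nat) (m : multinom n) (x : 'I_n -> R) (c : R) :
  \prod_(i < n) (x i / c) ^+ m i = (\prod_(i < n) x i ^+ m i) / c ^+ mdeg m.
Proof.
under eq_bigr do rewrite expr_div_n.
by rewrite prodf_div mdegE expr_sum.
Qed.

(** At a 0/1 point a monomial is 1 if its support lies in the set of ones and 0 otherwise, so the
    sum counts the k-subsets containing the support. *)
Lemma sum_orbit_vpt (R : realType) (d k : nat) (m : multinom d.+1) (c : R) :
  (k <= d.+1)%N ->
  \sum_(x \in perm_orbit (vpt R d k)) \prod_(i < d.+1) (tnth x i / c) ^+ m i =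
  'C(d.+1 - #|[pred i | m i != 0%N]|, d.+1 - k)%:R / c ^+ mdeg m.
Proof.
move=> kd; rewrite perm_orbit_vpt // fsbig_image; last first.
  by move=> A B _ _; exact: bool_point_inj.
rewrite fsbig_pred.
under eq_bigr do rewrite prod_div_mdeg.
rewrite -mulr_suml; congr (_ / _).
pose S := finset (fun i => m i != 0%N).
have -> : #|[pred i | m i != 0%N]| = #|S| by rewrite cardsE.
rewrite -card_supersets // -sum1_card natr_sum [LHS]big_mkcond [RHS]big_mkcond /=.
apply: eq_bigr => A _; rewrite inE andbC; case: eqP => //= _.
case: (boolP (S \subset A)) => [/fintype.subsetP SA|/fintype.subsetPn[i]].
  rewrite big1 // => i _; rewrite tnth_mktuple.
  have [->|mi] := eqVneq (m i) 0%N; first by rewrite expr0.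
  by rewrite SA ?inE // expr1n.
rewrite inE => mi iA; rewrite (bigD1 i) //= tnth_mktuple (negbTE iA).
by rewrite expr0n (negbTE mi) mul0r.
Qed.

Lemma sum_orbit_upt (R : realType) (d : nat) (a : R) (m : multinom d.+1) (c : R) :
  a != 1 ->
  \sum_(x \in perm_orbit (upt d a)) \prod_(i < d.+1) (tnth x i / c) ^+ m i =
  (\sum_(i < d.+1) a ^+ m i) / c ^+ mdeg m.
Proof.
move=> a1; rewrite perm_orbit_upt fsbig_image; last first.
  by move=> i j _ _; exact: upt_point_inj.
have -> : [set: 'I_d.+1] = [set i | xpredT i] by apply/seteqP; split.
rewrite (fsbig_pred xpredT).
under eq_bigr do rewrite prod_div_mdeg.
rewrite -mulr_suml; congr (_ / _); apply: eq_bigr => j _.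
rewrite (bigD1 j) //= tnth_mktuple eqxx big1 ?mulr1 // => i /negbTE ij.
by rewrite tnth_mktuple ij expr1n.
Qed.

(** * Integrals of polynomials over the simplex *)

Lemma prod_lift_simplex (R : realType) (d : nat) (m : 'I_d.+1 -> nat)
    (x : d.-tuple (measurableTypeR R)) :
  \prod_(i < d.+1) tnth (lift_simplex x) i ^+ m i =
  dirichlet (fun i => m (widen_ord (leqnSn d) i)) (m ord_max) x.
Proof.
rewrite big_ord_recr /dirichlet /=; congr (_ * _ ^+ _).
  apply: eq_bigr => i _; congr (_ ^+ _).
  by rewrite (tnth_nth 0) /= nth_rcons size_tuple ltn_ord -tnth_nth.
by rewrite (tnth_nth 0) /= nth_rcons size_tuple ltnn eqxx.
Qed.

Lemma integrable_dirichlet (R : realType) (n : nat) (al : 'I_n -> nat) b :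
  (lebesgue_tuple R n).-integrable (@std_simplex R n) (EFin \o dirichlet al b).
Proof.
apply/integrableP; split.
  apply/measurable_EFinP; apply: measurable_funTS; exact: measurable_dirichlet.
under eq_integral => x /set_mem Sx.
  rewrite /= ger0_norm ?dirichlet_ge0 //.
  over.
by rewrite integral_dirichlet ltry.
Qed.

Lemma Rintegral_lincomb d (T : measurableType d) (R : realType)
    (mu : {measure set T -> \bar R}) (D : set T) (I : Type) (r : seq I)
    (c : I -> R) (F : I -> T -> R) : measurable D ->
  (forall i, mu.-integrable D (EFin \o F i)) ->
  \int[mu]_(x in D) (\sum_(i <- r) c i * F i x) =
  \sum_(i <- r) c i * \int[mu]_(x in D) F i x.
Proof.
move=> mD intF.
have intcF i : mu.-integrable D (EFin \o (fun x => c i * F i x)).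
  exact: (@integrableZl _ _ _ _ _ mD (c i) _ (intF i)).
elim: r => [|i r IHr].
  by under eq_Rintegral do rewrite big_nil; rewrite big_nil /Rintegral integral0.
under eq_Rintegral do rewrite big_cons.
rewrite RintegralD //; first by rewrite IHr RintegralZl // big_cons.
have -> : EFin \o (fun x => \sum_(i <- r) c i * F i x) =
    fun x => (\sum_(i <- r) (c i * F i x)%:E)%E.
  by apply/funext => x /=; rewrite sumEFin.
by apply: integrable_sum => // j _; exact: intcF.
Qed.

Lemma Rintegral_simplex_meval (R : realType) (d : nat) (f : mpoly d.+1 R) :
  \int[lebesgue_tuple R d]_(x in @std_simplex R d)
    meval (tnth (lift_simplex x)) f =
  \sum_(m <- msupp f) mcoeff m f *
    ((\prod_(i < d.+1) (m i)`!)%:R / (d + mdeg m)`!%:R).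
Proof.
under eq_Rintegral => x _.
  rewrite mevalE.
  under eq_bigr do rewrite prod_lift_simplex.
  over.
rewrite (Rintegral_lincomb _ _ (@measurable_std_simplex R d)); last first.
  by move=> m; exact: integrable_dirichlet.
apply: eq_bigr => m _; congr (_ * _).
rewrite /Rintegral integral_dirichlet /= big_ord_recr /=.
by rewrite mdegE big_ord_recr /= addnA.
Qed.

(** * The weights and the moment equations *)

(* With n = d + 1, weight_k is lambda_k / k^4 for k = n, 1, 3, m, and weight_u
   is lambda_5 / (n (a + d)^4). *)
Section weights.
Variables (R : fieldType) (n m a : R).

Definition rising4 : R := n * (n + 1) * (n + 2) * (n + 3).

(** Let L(p) be the sum of weight_k p(k) over the nodes k = n, 1, 3, m. Up to the factor
    -n(n-1)(n-2) / (rising4 a), this is the value that the equations force on L(x(x-1)(x-3)(x-n)).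
    Only the node m contributes to it, which yields [weight_m]; the other nodes are treated
    likewise. *)
Definition node_excess : R := (n - 2) * (a - 2) - (3 * a - 4).

(** The difference of the equations for 31 and 22 reads weight_u (a^3 + a - 2a^2) = (6 - 4) /
    rising4, and a^3 + a - 2a^2 = a (a-1)^2. *)
Definition weight_u : R := 2 / (rising4 * a * (a - 1) ^+ 2).

Definition weight_m : R :=
  n * (n - 1) * (n - 2) * node_excess /
  (rising4 * a * m * (m - 1) * ((m - 3) * (n - m))).

Definition weight_3 : R :=
  n * (n - 1) * (n - 2) * ((m - 2) * (3 * a - 4) - (a - 2) * (m + n - 5)) /
  (6 * rising4 * a * (n - 3) * (m - 3)).

Definition weight_n : R :=
  ((a * (a - 1) ^+ 2 - 2 * (n - 4 + 4 * a)) * (n - 3) * (n - m) -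
     (a - 1) ^+ 2 * (m - 2) * node_excess) /
  (rising4 * a * (a - 1) ^+ 2 * (n - 3) * (n - m)).

Definition weight_1 : R :=
  n * (2 * (m - 1) * (19 * a - 2 * a ^+ 2 - 6) -
       (2 * (m - 1) * (n - 1) - (m - 2) * (n - 2)) * (3 * a - 4) +
       (n - 2) * (m + n - 3) * (a - 2)) /
  (2 * rising4 * a * (m - 1)).

End weights.

(** Makes falling factorials accessible to [field]. Truncated subtraction does no harm: for s > k
    the factor with i = k is already 0. *)
Lemma natr_ffact (R : comRingType) (k s : nat) :
  (k ^_ s)%:R = \prod_(i < s) (k%:R - i%:R) :> R.
Proof.
elim: s => [|s IHs]; first by rewrite big_ord0.
rewrite ffactnSr natrM IHs big_ord_recr /=.
have [sk|ks] := leqP s k; first by rewrite natrB.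
by rewrite -IHs ffact_small // !mul0r.
Qed.

Section weight_identities.
Variables (R : realType) (n m : nat) (a : R).
Hypotheses (n_gt3 : (3 < n)%N) (m_gt1 : (1 < m)%N) (m_neq3 : m != 3)
  (m_ltn : (m < n)%N) (a_gt1 : 1 < a).

Local Notation N := (n%:R : R).
Local Notation M := (m%:R : R).

Let n_gt3R : 3 < N. Proof. by rewrite (ltr_nat R 3). Qed.

Let m_gt1R : 1 < M. Proof. by rewrite (ltr_nat R 1). Qed.

Let m_neq3R : M - 3 != 0. Proof. by rewrite subr_eq0 (eqr_nat R m 3). Qed.

Let m_ltnR : M < N. Proof. by rewrite ltr_nat. Qed.

Let ratio k s : R := (k ^_ s)%:R / (n ^_ s)%:R.

(** The value of the rule on a monomial of degree 4 with [s] nonzero exponents e_i, where [x] stands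
    for the sum of all a^(e_i). *)
Definition node_moment s x : R :=
  weight_n N M a * ratio n s + weight_1 N M a * ratio 1 s +
  weight_3 N M a * ratio 3 s + weight_m N M a * ratio m s + weight_u N a * x.

Ltac solve_moment :=
  rewrite /node_moment /ratio ?natr_ffact ?big_ord_recr ?big_ord0 /=;
  rewrite /weight_n /weight_1 /weight_3 /weight_m /weight_u /node_excess /rising4;
  field; rewrite m_neq3R !lt0r_neq0 //; move: n_gt3R m_gt1R m_ltnR a_gt1; lra.

Lemma node_moment4 : node_moment 1 (N - 1 + a ^+ 4) = 24 / rising4 N.
Proof. solve_moment. Qed.

Lemma node_moment31 : node_moment 2 (N - 2 + a ^+ 3 + a) = 6 / rising4 N.
Proof. solve_moment. Qed.

Lemma node_moment22 : node_moment 2 (N - 2 + 2 * a ^+ 2) = 4 / rising4 N.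
Proof. solve_moment. Qed.

Lemma node_moment211 : node_moment 3 (N - 3 + a ^+ 2 + 2 * a) = 2 / rising4 N.
Proof. solve_moment. Qed.

Lemma node_moment1111 : node_moment 4 (N - 4 + 4 * a) = 1 / rising4 N.
Proof. solve_moment. Qed.

(** This is exactness for |x|_1^4, which equals 1 at every node; it is checked directly as an
    identity of rational functions. *)
Lemma sum_weights : N ^+ 4 * weight_n N M a + weight_1 N M a +
  3 ^+ 4 * weight_3 N M a + M ^+ 4 * weight_m N M a +
  N * (a + (N - 1)) ^+ 4 * weight_u N a = 1.
Proof. solve_moment. Qed.

End weight_identities.

(** * Nonnegativity of the weights *)

(* The denominators of weight_3 and weight_m change sign at m = 3. *)
Lemma divr_ge0_mul (R : realFieldType) (x y : R) : 0 <= x * y -> 0 <= x / y.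
Proof.
move=> xy; have [->|y0] := eqVneq y 0; first by rewrite invr0 mulr0.
have -> : x / y = x * y / y ^+ 2 by field.
by rewrite divr_ge0 // sqr_ge0.
Qed.

(* The values of m and a come from a numerical search; 16/3 fails for d > 15,
   and 11/2 fails for d = 15. *)
Lemma rule_parameters (R : realType) (d : nat) : (3 <= d <= 17)%N ->
  exists (m : nat) (a : R),
    [/\ (1 < m)%N, m != 3, (m < d.+1)%N & 1 < a] /\
    [/\ 0 <= weight_n d.+1%:R m%:R a, 0 <= weight_1 d.+1%:R m%:R a,
        0 <= weight_3 d.+1%:R m%:R a & 0 <= weight_m d.+1%:R m%:R a].
Proof.
pose m : nat := (if (d <= 4)%N then 2 else if (d <= 9)%N then 5
  else if (d <= 12)%N then 6 else if (d <= 15)%N then 7 else 8)%N.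
pose a : R := if (d <= 15)%N then 16 / 3 else 11 / 2.
move=> d_bounds; exists m, a; rewrite {}/m {}/a.
move: d_bounds; do 3 (case: d => [//|d]).
(* For each of the fifteen values of [d] the claims become inequalities between explicit rational
   numbers. *)
do 15 (case: d => [_|d]; first by split; [split => //=; lra|
  split; apply: divr_ge0_mul; rewrite /node_excess /rising4 /=; lra]).
by [].
Qed.

Lemma weight_u_ge0 (R : realType) (n : nat) (a : R) : 1 < a -> 0 <= weight_u n%:R a.
Proof.
move=> a1; have a0 : 0 <= a by apply: le_trans (ltW a1).
rewrite /weight_u /rising4 divr_ge0 //.
by rewrite !mulr_ge0 ?exprn_ge0 ?subr_ge0 ?(ltW a1) ?addr_ge0.
Qed.

(** * Exactness on monomials and the final rule *)

(** As d! / (d+4)! is 1 / rising4 at n = d + 1, each of the five partitions reduces to its moment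
    identity. *)
Lemma simplex_monomial (R : realType) (d m : nat) (a : R) (e : multinom d.+1) :
  (3 <= d)%N -> (1 < m)%N -> m != 3 -> (m < d.+1)%N -> 1 < a -> mdeg e = 4 ->
  d`!%:R * ((\prod_(i < d.+1) (e i)`!)%:R / (d + mdeg e)`!%:R) =
  node_moment d.+1 m a #|[pred i | e i != 0%N]| (\sum_(i < d.+1) a ^+ e i).
Proof.
move=> d3 m1 m3 md a1 e4.
have -> : d`!%:R * ((\prod_(i < d.+1) (e i)`!)%:R / (d + mdeg e)`!%:R) =
    (\prod_(i < d.+1) (e i)`!)%:R / rising4 d.+1%:R :> R.
  rewrite e4 addn4 !factS !natrM /rising4.
  have : d`!%:R != 0 :> R by rewrite pnatr_eq0 -lt0n fact_gt0.
  move: (\prod_(i < d.+1) _)%N (d`!) => u v v0.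
  by field; rewrite v0 !lt0r_neq0 //; have := ler0n R d; lra.
apply: (@mdeg4_elim R d.+1 a e (fun s p x =>
  p%:R / rising4 d.+1%:R = node_moment d.+1 m a s x) e4).
- by rewrite node_moment4.
- by rewrite node_moment31.
- by rewrite node_moment22.
- by rewrite node_moment211.
- by rewrite node_moment1111.
Qed.

(** The factor k^4 put into lambda cancels the scaling of the node by 1/k, and the quotient of
    binomials is the ratio of [bin_sub_ffact]. *)
Lemma orbit_ratio (R : realType) (d k s : nat) (w : R) :
  (1 <= k <= d.+1)%N -> (s <= d.+1)%N ->
  k%:R ^+ 4 * w / 'C(d.+1, k)%:R * ('C(d.+1 - s, d.+1 - k)%:R / k%:R ^+ 4) =
  w * ((k ^_ s)%:R / (d.+1 ^_ s)%:R).
Proof.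
move=> /andP[k0 kd] sd.
have k_neq0 : k%:R != 0 :> R by rewrite pnatr_eq0 -lt0n.
have C_neq0 : 'C(d.+1, k)%:R != 0 :> R by rewrite pnatr_eq0 -lt0n bin_gt0.
have f_neq0 : (d.+1 ^_ s)%:R != 0 :> R by rewrite pnatr_eq0 -lt0n ffact_gt0.
have := congr1 (fun j => j%:R : R) (bin_sub_ffact kd sd).
rewrite !natrM => H.
move: H f_neq0 C_neq0.
move: (_ ^_ _)%:R (_ ^_ _)%:R ('C(_, _)%:R) ('C(_, _)%:R) => x y z t H y0 z0.
have -> : t = z * x / y by rewrite -H mulfK.
by field; rewrite y0 z0 k_neq0.
Qed.

Theorem mainTheorem4 (R : realType) (d : nat) (hd : (3 <= d <= 17)%N) :
  exists (k : 4.-tuple nat) (a : R) (lam : 5.-tuple R),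
    [/\ uniq k,
        (forall j, (1 <= tnth k j <= d.+1)%N),
        (exists m : nat,
           k = [:: d.+1; 1; 2; m]%N :> seq nat \/
           k = [:: d.+1; 1; 3; m]%N :> seq nat) &
        0 < a /\ a <> 1] /\
    [/\ (forall j, 0 <= tnth lam j),
        \sum_(j < 5) tnth lam j = 1 &
        forall f : mpoly d.+1 R,
          f \is ishomog1 4 mdeg ->
          d`!%:R * \int[lebesgue_tuple R d]_(x in @std_simplex R d)
                      meval (tnth (lift_simplex x)) f =
          \sum_(j < 4) lam`_j / 'C(d.+1, tnth k j)%:R *
             (\sum_(x \in perm_orbit (vpt R d (tnth k j)))
                 eval_at f (tnth k j)%:R x)
          + lam`_4 / d.+1%:R *
             (\sum_(x \in perm_orbit (upt d a)) eval_at f (a + d%:R) x)].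
Proof.
have [m [a [[m1 m3 md a1] [wn0 w10 w30 wm0]]]] := rule_parameters R hd.
have d3 : (3 <= d)%N by case/andP: hd.
pose n : R := d.+1%:R.
(* The form (d+1, 1, 3, m) serves for every [d]. Each lambda restores the power of k or of a + d,
   and for the last orbit also the factor n, that its weight absorbed. *)
exists [tuple d.+1; 1; 3; m]%N, a,
  [tuple n ^+ 4 * weight_n n m%:R a; weight_1 n m%:R a; 3 ^+ 4 * weight_3 n m%:R a;
   m%:R ^+ 4 * weight_m n m%:R a; n * (a + (n - 1)) ^+ 4 * weight_u n a].
split; split.
- rewrite /= !inE !negb_or. lia.
- by move=> j; case: j => [[|[|[|[|j]]]] jlt] //; rewrite (tnth_nth 0%N) /=; lia.
- by exists m; right.
- by split; [lra|move=> a_eq1; rewrite a_eq1 ltxx in a1].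
- have wu0 := weight_u_ge0 d.+1 a1.
  have e0 : 0 <= a + (n - 1) by rewrite addr_ge0 ?subr_ge0 ?(ler_nat R 1) //; lra.
  move=> j; case: j => [[|[|[|[|[|j]]]]] jlt] //; rewrite (tnth_nth 0) /=.
  + by apply: mulr_ge0 wn0; rewrite exprn_ge0.
  + by apply: mulr_ge0 w30; rewrite exprn_ge0.
  + by apply: mulr_ge0 wm0; rewrite exprn_ge0.
  + by apply: mulr_ge0 wu0; rewrite mulr_ge0 // exprn_ge0.
- apply: etrans (@sum_weights R d.+1 m a d3 m1 m3 md a1).
  by rewrite !big_ord_recl big_ord0 /= !(tnth_nth 0) /= addr0 !addrA.
move=> f f4.
have f_deg e : e \in msupp f -> mdeg e = 4 by move=> /(allP f4) /eqP.
rewrite Rintegral_simplex_meval mulr_sumr.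
(* With [f] expanded into monomials, both sides become sums over its support and can be compared
   term by term. *)
have fsbig_meval (A : set (d.+1.-tuple R)) c : finite_set A ->
  \sum_(x \in A) eval_at f c x = \sum_(e <- msupp f) mcoeff e f *
    (\sum_(x \in A) \prod_(i < d.+1) (tnth x i / c) ^+ e i).
  move=> finA; rewrite /eval_at.
  under eq_fsbigr do rewrite mevalE.
  rewrite fsbig_finite // exchange_big /=.
  by apply: eq_bigr => e _; rewrite -mulr_sumr -fsbig_finite.
have fin_orbit (y : d.+1.-tuple R) : finite_set (perm_orbit y).
  by apply: finite_image; exact: finite_finset.
under [in RHS]eq_bigr do rewrite fsbig_meval // mulr_sumr.
rewrite fsbig_meval // mulr_sumr exchange_big -big_split /=.
rewrite big_seq [RHS]big_seq; apply: eq_bigr => e /f_deg e4.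
rewrite mulrCA (simplex_monomial d3 m1 m3 md a1 e4).
set s := #|[pred i | e i != 0%N]|.
(* This bound makes the denominator (n)_s nonzero. *)
have sd : (s <= d.+1)%N by rewrite -[X in (_ <= X)%N]card_ord max_card.
have vpt_term k w : (1 <= k <= d.+1)%N ->
    k%:R ^+ 4 * w / 'C(d.+1, k)%:R * (mcoeff e f *
      \sum_(x \in perm_orbit (vpt R d k)) \prod_(i < d.+1) (tnth x i / k%:R) ^+ e i) =
    mcoeff e f * (w * ((k ^_ s)%:R / (d.+1 ^_ s)%:R)).
  move=> kd; rewrite mulrCA sum_orbit_vpt ?e4; last by case/andP: kd.
  by rewrite orbit_ratio.
have upt_term := @sum_orbit_upt R d a e (a + d%:R) (negbT (gt_eqF a1)).
rewrite [X in _ = _ + _ * (_ * X)]upt_term e4.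
have nE : n - 1 = d%:R by rewrite /n -natr1 addrK.
move: (\sum_(i < d.+1) a ^+ e i) => X.
rewrite !big_ord_recl big_ord0 addr0.
rewrite ![tnth _ _](tnth_nth 0%N).
rewrite /=.
rewrite /node_moment 4!mulrDr -!addrA nE.
congr (_ + (_ + (_ + (_ + _)))).
- by rewrite -vpt_term // ltnSn.
- by rewrite -vpt_term // expr1n mul1r.
- by rewrite -vpt_term // (leq_trans d3) ?leqnSn.
- by rewrite -vpt_term // (ltnW m1) ltnW.
have n0 : n != 0 by rewrite pnatr_eq0.
have ad0 : a + d%:R != 0.
  by rewrite gt_eqF // ltr_pwDl // (lt_trans _ a1).
by rewrite -/n; clearbody n; field; rewrite n0 ad0.
Qed.
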